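(* There is a function $m$ assigning to each positive integer $n$ a real number $m(n)$ such that for every positive integer $n$ and every $n$-by-$n$ generalized doubly nonnegative (GDN) matrix $A$, the continuous power $A^\alpha$ is generalized doubly nonnegative for all $\alpha \ge m(n)$ (with $\alpha>0$).
   Context: A real $n$-by-$n$ matrix $A$ is called generalized doubly nonnegative (GDN) if it is entrywise nonnegative, diagonalizable, and all its eigenvalues are (real and) nonnegative. For a GDN matrix $A = SDS^{-1}$ with $D=\operatorname{diag}(\lambda_1,\dots,\lambda_n)$ diagonal, and a real number $\alpha>0$, the continuous (conventional) power is $A^\alpha := S D^\alpha S^{-1}$, where $D^\alpha := \operatorname{diag}(\lambda_1^\alpha,\dots,\lambda_n^\alpha)$ (with $0^\alpha = 0$). *)

(* Defs.v *)
From mathcomp Require Import all_boot all_order all_algebra.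
From mathcomp Require Import all_classical all_reals all_analysis.

Set Implicit Arguments.
Unset Strict Implicit.
Unset Printing Implicit Defensive.

Import GRing.Theory Num.Theory.

Local Open Scope ring_scope.

(* [diagonalizable] means diagonalizable over the real field R, which forces *)
(* every complex eigenvalue of A to be real; the last clause therefore bears *)
(* on the whole spectrum of A.                                               *)
Definition GDN (R : realType) (n : nat) (A : 'M[R]_n) : Prop :=
  [/\ forall i j, 0 <= A i j,
      diagonalizable A
    & forall a : R, eigenvalue A a -> 0 <= a].

Definition spectral_form (R : realType) (n : nat)
    (S : 'M[R]_n) (d : 'rV[R]_n) : 'M[R]_n :=
  S *m diag_mx d *m invmx S.

(* For alpha > 0, 0 `^ alpha = 0. For negative d 0 i, [powR] is a junk value; *)
(* that case does not occur for a GDN matrix.                                 *)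
Definition is_cpower (R : realType) (n : nat)
    (A : 'M[R]_n) (alpha : R) (B : 'M[R]_n) : Prop :=
  exists S d, [/\ S \in unitmx, A = spectral_form S d
                & B = spectral_form S (map_mx (fun x => x `^ alpha) d)].

(* A^alpha; it is 0 when A is not diagonalizable. Lemma [cpowerE] shows that *)
(* it does not depend on the chosen diagonalization.                         *)
Definition cpower (R : realType) (n : nat) (A : 'M[R]_n) (alpha : R) :
    'M[R]_n :=
  xget 0 [set B | is_cpower A alpha B].

Lemma spectral_form_map_uniq (R : realType) (n : nat) (f : R -> R)
    (S T : 'M[R]_n) (d e : 'rV[R]_n) :
  S \in unitmx -> T \in unitmx -> spectral_form S d = spectral_form T e ->
  spectral_form S (map_mx f d) = spectral_form T (map_mx f e).
Proof.
rewrite /spectral_form => Su Tu eST.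
pose P := invmx T *m S.
have eP : P *m diag_mx d = diag_mx e *m P.
  have : invmx T *m (S *m diag_mx d *m invmx S) *m S =
         invmx T *m (T *m diag_mx e *m invmx T) *m S by rewrite eST.
  by rewrite /P !mulmxA mulmxKV // mulVmx // mul1mx.
have fP : P *m diag_mx (map_mx f d) = diag_mx (map_mx f e) *m P.
  apply/matrixP => i j; move/matrixP: eP => /(_ i j).
  rewrite !mul_mx_diag !mul_diag_mx !mxE [e 0 i * _]mulrC [f (e 0 i) * _]mulrC.
  case: (eqVneq (\sum_k invmx T i k * S k j) 0) => [-> _|P0].
    by rewrite !mul0r.
  by move/(mulfI P0) ->.
have -> : S *m diag_mx (map_mx f d) = T *m (P *m diag_mx (map_mx f d)).
  by rewrite /P !mulmxA mulmxV // mul1mx.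
by rewrite fP /P !mulmxA mulmxK.
Qed.

Lemma cpowerE (R : realType) (n : nat) (S : 'M[R]_n) (d : 'rV[R]_n)
    (alpha : R) :
  S \in unitmx ->
  cpower (spectral_form S d) alpha =
  spectral_form S (map_mx (fun x => x `^ alpha) d).
Proof.
move=> Su; rewrite /cpower; case: xgetP => [B _ [T [e [Tu eA ->]]]|H].
  by apply/esym/spectral_form_map_uniq.
by case: (H (spectral_form S (map_mx (fun x => x `^ alpha) d))); exists S, d.
Qed.

Lemma diagonalizable_spectral_form (R : realType) (n : nat) (A : 'M[R]_n) :
  diagonalizable A <-> exists S d, S \in unitmx /\ A = spectral_form S d.
Proof.
split=> [[P Pu /(similar_diagLR Pu)[d eA]]|[S [d [Su eA]]]].
  exists (invmx P), d; rewrite unitmx_inv; split=> //.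
  by rewrite eA conjumx ?unitmx_inv.
exists (invmx S); first by rewrite unitmx_inv.
apply/similar_diagPex; exists d; apply/similarLR; first by rewrite unitmx_inv.
by rewrite eA invmxK conjumx.
Qed.

(* Main.v *)
(** For x > 0 every entry of A^x is an exponential sum with at most n terms, so
    it has at most n - 1 zeros unless it vanishes identically. It is nonnegative
    at the positive integers; hence it cannot be negative at n + 1 points
    pairwise separated by integers, since the intermediate value theorem would
    give n distinct zeros.
    On the other hand, if A^alpha has a negative entry then so does every
    A^(alpha - j) with alpha - j > 0, because A^alpha = A^(alpha - j) A^j. When
    alpha >= n^3 + 1 there are n^3 + 1 such exponents, and by pigeonhole some
    single entry is negative at n + 1 of them: a contradiction. *)

Require Import Defs.
From mathcomp Require Import all_boot all_order all_algebra.
From mathcomp Require Import all_classical all_reals all_analysis.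
From mathcomp Require Import ring.
Import Order.TTheory GRing.Theory Num.Theory.
Import numFieldNormedType.Exports.
Local Open Scope ring_scope.

Definition expsum {R : realType} {n : nat} (c a : 'I_n -> R) (x : R) : R :=
  \sum_(i < n) c i * expR (a i * x).

Lemma is_derive_expsum {R : realType} {n : nat} (c a : 'I_n -> R) (x : R) :
  is_derive x 1 (expsum c a) (expsum (fun i => c i * a i) a x).
Proof.
have -> : expsum c a = \sum_(i < n) (fun y => c i * expR (a i * y)).
  by apply/funext => y; rewrite /expsum fct_sumE.
apply: is_derive_sum => i.
have dE : is_derive x 1 (expR \o ( *%R (a i))) (expR (a i * x) * a i).
  apply: is_derive1_comp.
  by apply: is_derive_eq; rewrite [LHS]mulr1.
have dcE : is_derive x 1 (c i *: (expR \o ( *%R (a i))))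
    (c i *: (expR (a i * x) * a i)) by apply: is_deriveZ.
apply: (is_derive_eq dcE).
by rewrite -[LHS]/(c i * _) mulrCA mulrC.
Qed.

Lemma continuous_expsum {R : realType} {n : nat} (c a : 'I_n -> R)
    (A : interval R) :
  {within [set` A], continuous (expsum c a)}%classic.
Proof.
apply: derivable_within_continuous => z _.
exact: (@ex_derive _ _ _ _ _ _ _ (is_derive_expsum c a z)).
Qed.

Lemma expsum_Rolle {R : realType} {n : nat} (c a : 'I_n -> R) (x y : R) :
  x < y -> expsum c a x = expsum c a y ->
  exists2 z, x < z < y & expsum (fun i => c i * a i) a z = 0.
Proof.
move=> xy exy.
have [||z] := Rolle xy _ _ exy.
- by move=> z _; exact: (@ex_derive _ _ _ _ _ _ _ (is_derive_expsum c a z)).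
- exact: continuous_expsum.
rewrite in_itv /= => xzy dz; exists z => //.
by rewrite -(@derive_val _ _ _ _ _ _ _ (is_derive_expsum c a z)) derive_val.
Qed.

(* Multiplying by expR (- a 0 * x) makes the first term constant, so
   differentiating drops it: n + 1 zeros of n + 1 terms give, by Rolle, n zeros
   of n terms. The exponents need not be distinct. *)
Lemma expsum_eq0 {R : realType} {n : nat} (c a : 'I_n -> R) (z : nat -> R) :
  (forall i, (i.+1 < n)%N -> z i < z i.+1) ->
  (forall i, (i < n)%N -> expsum c a (z i) = 0) ->
  forall x, expsum c a x = 0.
Proof.
elim: n c a z => [|n IH] c a z zlt z0 x; first by rewrite /expsum big_ord0.
pose b i := a i - a ord0.
have gE y : expsum c b y = expR (- a ord0 * y) * expsum c a y.
  rewrite /expsum mulr_sumr; apply: eq_bigr => i _.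
  by rewrite mulrCA -expRD -mulrDl [- _ + _]addrC.
have dE y : expsum (fun i => c i * b i) b y =
    expsum (fun i => c (lift ord0 i) * b (lift ord0 i)) (b \o lift ord0) y.
  by rewrite /expsum big_ord_recl /b subrr mulr0 mul0r add0r.
have /choice [w wP] : forall i, exists w, (i < n)%N ->
    z i < w < z i.+1 /\ expsum (fun i => c i * b i) b w = 0.
  move=> i; case: (ltnP i n) => [lt_in|]; last by exists 0.
  have [|w wi w0] := expsum_Rolle c b _ _ (zlt i lt_in); last by exists w.
  by rewrite !gE !z0 ?mulr0 // ltnW.
have d0 y : expsum (fun i => c i * b i) b y = 0.
  rewrite dE; apply: (IH _ _ w) => [i lt_in|i lt_in].
    have [/andP[_ w1] _] := wP i (ltnW lt_in).
    by have [/andP[w2 _] _] := wP i.+1 lt_in; apply: lt_trans w1 w2.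
  by rewrite -dE; case: (wP i lt_in).
have gcst : expsum c b x = expsum c b (z 0%N).
  by apply: is_derive_0_is_cst => y; rewrite -(d0 y); apply: is_derive_expsum.
move: gcst; rewrite !gE z0 // mulr0 => /eqP.
by rewrite mulf_eq0 (gt_eqF (expR_gt0 _)) => /eqP.
Qed.

(** The intermediate value theorem gives a zero in each [[x i, y i]]. These [n] zeros force the sum
    to vanish identically by [expsum_eq0], against its sign at [x 0]. *)
Lemma expsum_sign_changes {R : realType} {n : nat} (c a : 'I_n -> R)
    (x y : nat -> R) :
  (forall i, (i < n)%N -> x i <= y i <= x i.+1) ->
  (forall i, (i <= n)%N -> expsum c a (x i) < 0) ->
  (forall i, (i < n)%N -> 0 <= expsum c a (y i)) -> False.
Proof.
move=> xy xneg ynneg.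
have /choice [z zP] : forall i, exists z, (i < n)%N ->
    x i < z < x i.+1 /\ expsum c a z = 0.
  move=> i; case: (ltnP i n) => [lt_in|]; last by exists 0.
  have /andP[x_y y_x] := xy i lt_in.
  have xi := xneg i (ltnW lt_in); have yi := ynneg i lt_in.
  have [|z zi z0] :=
    @IVT R (expsum c a) (x i) (y i) 0 x_y (continuous_expsum c a _).
    by rewrite ge_min le_max yi (ltW xi) orbT.
  exists z => _; split => //; move: zi; rewrite in_itv /= => /andP[xz zy].
  have xj := xneg i.+1 lt_in.
  (* The sum is negative at both [x i] and [x i.+1], so the zero is neither; hence successive zeros
     are distinct. *)
  rewrite !lt_neqAle xz (le_trans zy y_x) !andbT; apply/andP; split.
    by apply: contraTneq xi => ->; rewrite z0 ltxx.
  by apply: contraTneq xj => <-; rewrite z0 ltxx.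
have := xneg 0%N isT; rewrite (expsum_eq0 _ _ z) ?ltxx //.
  move=> i lt_in; have [/andP[_ w1] _] := zP i (ltnW lt_in).
  by have [/andP[w2 _] _] := zP i.+1 lt_in; apply: lt_trans w1 w2.
by move=> i lt_in; case: (zP i lt_in).
Qed.

(** Some fibre of [f] below [N] has more than [m] points, and [g] lists it in increasing order,
    ready to index the points of [expsum_sign_changes]. *)
Lemma pigeonhole_chain {T : finType} (m N : nat) (f : nat -> T) :
  (#|T| * m < N)%N ->
  exists (t : T) (g : nat -> nat),
    (forall i, (i < m)%N -> (g i < g i.+1)%N) /\
    (forall i, (i <= m)%N -> (g i < N)%N /\ f (g i) = t).
Proof.
move=> ltN; pose s t := [seq j <- iota 0 N | f j == t].
have [t lt_ms] : exists t, (m < size (s t))%N.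
  apply: contrapT => /forallNP noT; move: ltN; rewrite ltnNge => /negP; apply.
  rewrite -[leqLHS](size_iota 0) -sum1_size (partition_big f predT) //=.
  rewrite -sum_nat_const; apply: leq_sum => t _.
  rewrite sum1_count -size_filter; apply: contraT.
  by rewrite -ltnNge => /noT.
exists t, (nth 0%N (s t)); split=> i lt_im.
  apply: (sorted_ltn_nth ltn_trans) => //; rewrite ?inE.
  - exact/(sorted_filter ltn_trans)/iota_ltn_sorted.
  - exact: ltn_trans lt_im lt_ms.
  - exact: leq_ltn_trans lt_im lt_ms.
have : nth 0%N (s t) i \in s t by apply/mem_nth/(leq_ltn_trans lt_im).
by rewrite mem_filter mem_iota /= => /andP[/eqP-> ->].
Qed.

Lemma spectral_formE {R : realType} {n : nat} (S : 'M[R]_n) (d : 'rV[R]_n)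
    (i j : 'I_n) :
  spectral_form S d i j = \sum_k S i k * invmx S k j * d 0 k.
Proof.
rewrite /spectral_form mul_mx_diag mxE; apply: eq_bigr => k _.
by rewrite mxE mulrAC.
Qed.

(** Eigenvectors are rows: [v] is one exactly when [v *m S] is one for [diag_mx d], and the rows of
    [invmx S] realize every [d 0 k]. *)
Lemma eigenvalue_spectral_form {R : realType} {n : nat} (S : 'M[R]_n)
    (d : 'rV[R]_n) (a : R) :
  S \in unitmx ->
  reflect (exists k, d 0 k = a) (eigenvalue (spectral_form S d) a).
Proof.
move=> Su; apply: (iffP idP) => [/eigenvalueP[v vE v0]|[k <-]].
  have wE : v *m S *m diag_mx d = a *: (v *m S).
    by rewrite scalemxAl -vE /spectral_form !mulmxA mulmxKV.
  have /rV0Pn [k wk] : v *m S != 0.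
    by apply: contraNneq v0 => w0; rewrite -[v](mulmxK Su) w0 mul0mx.
  exists k; move/matrixP/(_ 0 k): wE; rewrite mul_mx_diag !mxE mulrC.
  by move: wk; rewrite mxE => wk /(mulIf wk).
apply/eigenvalueP; exists (row k (invmx S)).
  apply/rowP => j; rewrite -row_mul /spectral_form !mulmxA mulVmx // mul1mx.
  by rewrite mul_diag_mx !mxE.
apply/negP => /eqP r0; have := row_mul k (invmx S) S.
rewrite r0 mul0mx mulVmx // => /rowP/(_ k)/eqP.
by rewrite !mxE eqxx oner_eq0.
Qed.

Definition powmx {R : realType} {n : nat} (S : 'M[R]_n) (d : 'rV[R]_n)
    (x : R) : 'M[R]_n :=
  spectral_form S (map_mx (fun a => a `^ x) d).

Lemma powmxD {R : realType} {n : nat} (S : 'M[R]_n) (d : 'rV[R]_n) (x y : R) :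
  S \in unitmx -> 0 < x -> 0 < y ->
  powmx S d (x + y) = powmx S d x *m powmx S d y.
Proof.
move=> Su x0 y0; rewrite /powmx /spectral_form !mulmxA mulmxKV //.
congr (_ *m _); rewrite -mulmxA mulmx_diag; congr (_ *m diag_mx _).
(* For base 0 the exponent law can fail when [x + y = 0], as 0 to the power 0 is 1; positivity
   excludes this. *)
by apply/rowP => k; rewrite !mxE powRD // gt_eqF ?addr_gt0.
Qed.

(* The factor [d 0 k != 0] is there because [ln 0 = 0]. *)
Lemma powmx_expsum {R : realType} {n : nat} (S : 'M[R]_n) (d : 'rV[R]_n)
    (i j : 'I_n) (x : R) :
  0 < x ->
  powmx S d x i j = expsum (fun k => S i k * invmx S k j * (d 0 k != 0)%:R)
                           (fun k => ln (d 0 k)) x.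
Proof.
move=> x0; rewrite /powmx spectral_formE; apply: eq_bigr => k _.
rewrite mxE /powR; case: eqP => _; last by rewrite mulr1 [ln _ * _]mulrC.
by rewrite (gt_eqF x0) !mulr0 mul0r.
Qed.

Lemma powmx1 {R : realType} {n : nat} (S : 'M[R]_n) (d : 'rV[R]_n) :
  (forall k, 0 <= d 0 k) -> powmx S d 1 = spectral_form S d.
Proof.
by move=> d0; congr spectral_form; apply/rowP => k; rewrite mxE powRr1.
Qed.

(** Each unit step multiplies by the nonnegative matrix [powmx S d 1]. Read backwards, a negative
    entry at [x + k] forces one at [x]. *)
Lemma powmx_ge0D {R : realType} {n : nat} (S : 'M[R]_n) (d : 'rV[R]_n)
    (x : R) (k : nat) :
  S \in unitmx -> 0 < x ->
  (forall i j, 0 <= powmx S d 1 i j) -> (forall i j, 0 <= powmx S d x i j) ->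
  forall i j, 0 <= powmx S d (x + k%:R) i j.
Proof.
move=> Su x0 P1 Px; elim: k => [|k IH] i j; first by rewrite addr0.
rewrite -natr1 addrA powmxD // ?ltr_wpDr // mxE.
by apply: sumr_ge0 => l _; apply: mulr_ge0.
Qed.

Lemma powmx_ge0 {R : realType} {n : nat} (S : 'M[R]_n) (d : 'rV[R]_n) (x : R) :
  S \in unitmx -> (forall i j, 0 <= powmx S d 1 i j) ->
  (n * n * n).+1%:R <= x ->
  forall i j, 0 <= powmx S d x i j.
Proof.
move=> Su P1; set N := (n * n * n).+1 => Nx.
case: (pselect (forall i j, 0 <= powmx S d x i j)) => // Pneg; exfalso.
(* For [j < N] these are the exponents [x - (N - 1), ..., x], positive because [N <= x]. *)
pose u j := x - N%:R + 1 + j%:R.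
have u0 j : 0 < u j by rewrite /u ltr_wpDr // ltr_wpDl // subr_ge0.
have /choice [f fP] : forall j, exists p : 'I_n * 'I_n,
    (j < N)%N -> powmx S d (u j) p.1 p.2 < 0.
  move=> j; case: (ltnP j N) => [lt_jN|_]; last first.
    (* Beyond [N] any index pair will do; one exists, since otherwise [Pneg] would fail
       vacuously. *)
    have [p] : exists p : 'I_n * 'I_n, True.
      apply: contrapT => nop; apply: Pneg => i k.
      by case: nop; exists (i, k).
    by move=> _; exists p.
  apply: contrapT => nop; apply: Pneg.
  have -> : x = u j + (N.-1 - j)%:R.
    rewrite /u natrB // [N in - N%:R](_ : N = N.-1.+1) // -natr1.
    by rewrite opprD !addrA; ring.
  apply: powmx_ge0D => // i k; rewrite leNgt; apply/negP => neg.
  by apply: nop; exists (i, k).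
have [|[i k] [g [gS gP]]] := @pigeonhole_chain _ n N f.
  by rewrite card_prod card_ord.
(* The first integer above [u (g j)]: at most [u (g j) + 1], hence at most [u (g j.+1)]. The matrix
   power there is nonnegative. *)
pose y j : R := (Num.truncn (u (g j))).+1%:R.
pose c l := S i l * invmx S l k * (d 0 l != 0)%:R.
pose a l := ln (d 0 l).
apply: (@expsum_sign_changes R n c a (fun j => u (g j)) y) => j le_jn.
- rewrite (ltW (truncnS_gt _)) /=; apply: (@le_trans _ _ (u (g j) + 1)).
    by rewrite /y -natr1 lerD2r truncn_le ltW.
  by rewrite /u -addrA natr1 lerD2l ler_nat gS.
- rewrite -powmx_expsum //; have [lt_gN eg] := gP j le_jn.
  by have := fP _ lt_gN; rewrite eg.
rewrite -powmx_expsum // /y -natr1 addrC.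
by apply: powmx_ge0D.
Qed.

Theorem theorem3p1 (R : realType) :
  exists m : nat -> R,
    forall n : nat, (0 < n)%N ->
    forall A : 'M[R]_n, GDN A ->
    forall alpha : R, 0 < alpha -> m n <= alpha ->
    GDN (cpower A alpha).
Proof.
exists (fun n => (n * n * n).+1%:R) => n _ A.
case=> A0 /diagonalizable_spectral_form[S [d [Su eA]]] Aev alpha _ mle.
(* Nonnegativity of [d] gives [powmx S d 1 = A], so [powmx_ge0] can start from [A0]. *)
have d0 k : 0 <= d 0 k.
  by apply: Aev; rewrite eA; apply/eigenvalue_spectral_form => //; exists k.
rewrite eA cpowerE //; split.
- by apply: powmx_ge0 => // i j; rewrite powmx1 // -eA.
- by apply/diagonalizable_spectral_form; exists S, (map_mx (fun a => a `^ alpha) d).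
- by move=> a /eigenvalue_spectral_form[] // k <-; rewrite mxE powR_ge0.
Qed.
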